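(* Let $P\in\mathbb{Z}[x]$. The set $\{P(n):n\in\mathbb{N}\}$ contains an infinite subsemigroup of $(\mathbb{Q}^{>0},\times)$ if and only if $P(x)=(ax+b)^d$ for some $a,d\in\mathbb{N}$ and $b\in\mathbb{Z}$ with $a\mid b(b-1)$.
   Context: $\mathbb{N}=\{1,2,\dots\}$; $\mathbb{Q}^{>0}$ is the set of positive rational numbers. *)

(* Defs.v *)
From mathcomp Require Import all_boot all_order all_algebra.
From mathcomp Require Import classical_sets cardinality.

Set Implicit Arguments.
Unset Strict Implicit.
Unset Printing Implicit Defensive.

Import Order.TTheory GRing.Theory Num.Theory.

Local Open Scope classical_set_scope.
Local Open Scope ring_scope.

Definition posrat_subsemigroup (S : set rat) : Prop :=
  (forall x, S x -> 0 < x) /\ (forall x y, S x -> S y -> S (x * y)).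

(* The values are regarded as rationals; n starts at 1. *)
Definition poly_values (P : {poly int}) : set rat :=
  [set P.[n%:Z]%:~R | n in [set n : nat | (0 < n)%N]].

(* Main.v *)
Require Import Defs.
From mathcomp Require Import all_boot all_order all_algebra.
From mathcomp Require Import classical_sets cardinality.
From mathcomp Require Import boolp zify ring.

Set Implicit Arguments.
Unset Strict Implicit.
Unset Printing Implicit Defensive.

Import Order.TTheory GRing.Theory Num.Theory.

Local Open Scope classical_set_scope.
Local Open Scope ring_scope.

(** An infinite subsemigroup of the values of P contains some s > 1, hence all
the powers s ^ k with k > 0; write s ^ k = P (f k).  Only these powers are used
to show that P is the power of a linear polynomial.  Let P have degree d and
leading coefficient c.  Completing the d-th power gives a linear polynomial L
and a constant K > 0 with K P = L ^ d + T, where T has degree at most d - 2.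
Let y j be the value of L at f (d j), a point where P takes the d-th power
value (s ^ j) ^ d.  Since K P is multiplied by s ^ d when j increases by 1,
   y (j+1) ^ d - (s y j) ^ d
is a combination of two values of T, hence eventually negligible against the
(d-1)-st powers of y j and y (j+1).  But the d-th powers of distinct positive
integers are at least a (d-1)-st power apart, so y (j+1) = s y j exactly for large j
([close_powers_eq]).  Thus y j is proportional to s ^ j, so P and L ^ d are
proportional at infinitely many points and therefore as polynomials.  The
leading and the constant coefficient show that the factor of proportionality
can be absorbed into integer coefficients: P = (a X + b) ^ d
([linear_power_of_values]).

The congruence comes from comparing s ^ k with s ^ (2 k) for one large k, where
the values of a X + b are positive and the d-th root can be taken: a m + b =
(a n + b) ^ 2, so b = b ^ 2 modulo a ([linear_power_dvd]).

Conversely, if a divides b (b - 1), the positive values of a X + b at positive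
integers are closed under multiplication, and so are their d-th powers
([linear_power_subsemigroup]). *)

(** * Integer polynomials at large arguments *)

Lemma poly_eventually_gt0 (p : {poly int}) :
  0 < lead_coef p -> exists N : nat, forall n, (N <= n)%N -> 0 < p.[n%:Z].
Proof.
elim/poly_ind: p => [|p c IHp]; first by rewrite lead_coef0.
have [->|p0] := eqVneq p 0.
  rewrite mul0r add0r lead_coefC => c_gt0.
  by exists 0%N => n _; rewrite hornerC.
rewrite lead_coefDl ?lead_coefMX => [/IHp[N HN]|]; last first.
  by rewrite size_mulX // ltnS (leq_trans (size_polyC_leq1 c)) // size_poly_gt0.
exists (N + `|c|.+1)%N => n len; rewrite hornerMXaddC.
have := HN n ltac:(lia); nia.
Qed.

Lemma poly_eventually_neq0 (p : {poly int}) :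
  p != 0 -> exists N : nat, forall n, (N <= n)%N -> p.[n%:Z] != 0.
Proof.
move=> p0; have := lead_coef_eq0 p; rewrite (negbTE p0).
have [lt0 _|gt0 _|//] := ltrgt0P (lead_coef p).
  have [N HN] := poly_eventually_gt0 lt0.
  by exists N => n /HN; rewrite lt0r => /andP[].
have [|N HN] := @poly_eventually_gt0 (- p); first by rewrite lead_coefN oppr_gt0.
by exists N => n /HN; rewrite hornerN oppr_gt0 lt_neqAle => /andP[].
Qed.

(** Both q - M p and q + M p have the leading coefficient of q, so both are
eventually positive. *)
Lemma poly_eventually_dominated (p q : {poly int}) (M : int) :
    0 < lead_coef q -> (size p < size q)%N ->
  exists N : nat, forall n, (N <= n)%N -> M * `|p.[n%:Z]| < q.[n%:Z].
Proof.
move=> q_gt0 ltpq.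
have bound c : exists N, forall n : nat, (N <= n)%N -> c * p.[n%:Z] < q.[n%:Z].
  have [|N HN] := @poly_eventually_gt0 (q - c *: p).
    rewrite lead_coefDl // size_polyN.
    exact: leq_ltn_trans (size_scale_leq _ _) ltpq.
  by exists N => n /HN; rewrite !hornerE subr_gt0.
have [[N1 HN1] [N2 HN2]] := (bound M, bound (- M)).
exists (N1 + N2)%N => n len.
have := HN1 n ltac:(lia); have := HN2 n ltac:(lia).
by case: (ger0P p.[n%:Z]); lia.
Qed.

Lemma ltn_exprz (s : int) k : 1 < s -> k%:Z < s ^+ k.
Proof. by move=> s1; elim: k => [|k IHk]; rewrite ?exprS //; nia. Qed.

(** P takes only finitely many values on arguments below N, while the values
s ^ k grow without bound. *)
Lemma power_indices_unbounded (P : {poly int}) (s : int) (f : nat -> nat) :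
    1 < s -> (forall k, (0 < k)%N -> P.[(f k)%:Z] = s ^+ k) ->
  forall N, exists J, forall k, (J <= k)%N -> (N <= f k)%N.
Proof.
move=> s1 Hf N; exists (\sum_(i < N) `|P.[i%:Z]|).+1%N => k ltk.
rewrite leqNgt; apply/negP => ltN.
have := ltn_exprz k s1; rewrite -Hf; last by lia.
by move: ltk; rewrite (bigD1 (Ordinal ltN)) //=; lia.
Qed.

(** * Completing the power *)

Lemma coef_linear_exp (R : comNzRingType) (a b : R) n i :
  ((a *: 'X + b%:P) ^+ n)`_i = a ^+ i * b ^+ (n - i) *+ 'C(n, i).
Proof.
rewrite addrC exprDn.
rewrite (eq_bigr (fun i : 'I_n.+1 =>
   (a ^+ i * b ^+ (n - i) *+ 'C(n, i)) *: 'X^i)) => [|j _]; last first.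
  by rewrite -polyC_exp exprZn mul_polyC scalerA mulrC scalerMnl.
rewrite -(poly_def n.+1 (fun i => a ^+ i * b ^+ (n - i) *+ 'C(n, i))) coef_poly.
by case: ltnP => // ltni; rewrite bin_small.
Qed.

(** The analogue of completing the square: with d = e+1, the polynomials P and
c (X + P_e / (d c)) ^ d have the same coefficients of degree d and e, and
multiplying by d ^ d c ^ e clears the denominators of the latter.  Losing two degrees, not one, is what makes the
remainder negligible against L ^ e. *)
Lemma size_complete_power (P : {poly int}) e
    (c := P`_e.+1) (L := (e.+1%:R * c) *: 'X + (P`_e)%:P) :
    (size P <= e.+2)%N ->
  (size ((e.+1%:R ^+ e.+1 * c ^+ e) *: P - L ^+ e.+1)%R <= e)%N.
Proof.
move=> sP; apply/leq_sizeP => j.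
rewrite coefB coefZ coef_linear_exp leq_eqVlt => /predU1P[<-|].
  rewrite binSn subSnn expr1 -[X in _ - X]mulr_natr exprMn.
  by rewrite [_ ^+ e.+1]exprS; ring.
rewrite leq_eqVlt => /predU1P[<-|ltj].
  by rewrite binn subnn -/c exprMn exprS [c ^+ e.+1]exprS; ring.
by rewrite bin_small // mulr0n subr0 nth_default ?mulr0 // (leq_trans sP).
Qed.

Lemma expr_gap (x y : int) e : 0 <= x < y -> y ^+ e <= y ^+ e.+1 - x ^+ e.+1.
Proof.
case/andP=> x0 ltxy; rewrite !exprS.
have: x ^+ e <= y ^+ e by apply: lerXn2r; rewrite ?nnegrE; lia.
have: 0 <= x ^+ e by exact: exprn_ge0.
nia.
Qed.

(** Distinct (e+1)-st powers differ by at least the e-th power of the larger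
base, hence by at least the mean of the two e-th powers. *)
Lemma close_powers_eq (x y : int) e : 0 <= x -> 0 <= y ->
  2 * `|x ^+ e.+1 - y ^+ e.+1| < x ^+ e + y ^+ e -> x = y.
Proof.
move=> x0 y0 close; case: (ltrgtP x y) => // ltxy.
  have := @expr_gap x y e ltac:(lia).
  have: x ^+ e <= y ^+ e by apply: lerXn2r; rewrite ?nnegrE; lia.
  lia.
have := @expr_gap y x e ltac:(lia).
have: y ^+ e <= x ^+ e by apply: lerXn2r; rewrite ?nnegrE; lia.
lia.
Qed.

(** Comparing the coefficients of degree d and 0 shows that u ^ d divides A ^ d
and B ^ d; over the integers, u then divides A and B. *)
Lemma linear_exp_divide (P : {poly int}) (u A B : int) d :
    (0 < d)%N -> 0 < u -> 0 < A -> u ^+ d *: P = (A *: 'X + B%:P) ^+ d ->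
  exists a b : int, 0 < a /\ P = (a *: 'X + b%:P) ^+ d.
Proof.
move=> d0 u0 A0 eqP.
have /dvdzP[a Aa] : (u %| A)%Z.
  rewrite -(dvdz_pexp2r u A d0); apply/dvdzP; exists P`_d; rewrite mulrC.
  have := congr1 (fun p : {poly int} => p`_d) eqP.
  by rewrite coefZ coef_linear_exp subnn binn mulr1 => ->.
have /dvdzP[b Bb] : (u %| B)%Z.
  rewrite -(dvdz_pexp2r u B d0); apply/dvdzP; exists P`_0; rewrite mulrC.
  have := congr1 (fun p : {poly int} => p`_0) eqP.
  by rewrite coefZ coef_linear_exp subn0 bin0 mul1r => ->.
exists a, b; split; first by nia.
have ud0 : (u ^+ d)%:P != 0 by rewrite polyC_eq0 expf_eq0 gt_eqF // andbF.
apply: (mulfI ud0); rewrite !mul_polyC eqP Aa Bb -exprZn; congr (_ ^+ d).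
by rewrite scalerDr scalerA -[u *: b%:P]mul_polyC -polyCM mulrC [b * u]mulrC.
Qed.

(** * A polynomial taking all powers of s as values *)

(** The heart of the proof: an approximate recurrence for the values of the linear
polynomial L becomes exact because these values are integers. *)
Lemma linear_power_of_values (P : {poly int}) (s : int) (f : nat -> nat) :
    1 < s -> (forall k, (0 < k)%N -> P.[(f k)%:Z] = s ^+ k) ->
  exists (a b : int) (d : nat),
    [/\ 0 < a, (0 < d)%N & P = (a *: 'X + b%:P) ^+ d].
Proof.
move=> s1 Hf; have unb := power_indices_unbounded s1 Hf.
(* Otherwise P would be zero, or negative at large f k, where it equals
s ^ k > 0. *)
have lcP : 0 < lead_coef P.
  rewrite ltNge; apply/negP => le0.
  have P0 : P != 0.
    by apply/eqP => P0; have := Hf 1%N isT; rewrite P0 horner0; lia.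
  have [|N HN] := @poly_eventually_gt0 (- P).
    by rewrite lead_coefN oppr_gt0 lt_neqAle lead_coef_eq0 P0.
  have [J HJ] := unb N.
  have := HN (f J.+1) (HJ _ (leqnSn J)); rewrite hornerN Hf //.
  by have := ltn_exprz J.+1 s1; lia.
(* P is not constant since it takes the distinct values s and s ^ 2. *)
have [e sP] : exists e, size P = e.+2.
  case sP: (size P) => [|[|e]]; last by exists e.
    by move/eqP: sP lcP; rewrite size_poly_eq0 => /eqP ->; rewrite lead_coef0.
  have := Hf 1%N isT; have := Hf 2%N isT.
  rewrite (size1_polyC (eq_leq sP)) !hornerC expr1 => -> /eqP.
  by rewrite expr2; nia.
pose c := P`_e.+1; pose d : int := e.+1%:R.
have c0 : 0 < c by move: lcP; rewrite lead_coefE sP.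
have dc0 : 0 < d * c by rewrite mulr_gt0.
pose L := (d * c) *: 'X + (P`_e)%:P.
pose K := d ^+ e.+1 * c ^+ e.
pose T := K *: P - L ^+ e.+1.
have sL : size L = 2.
  by rewrite /L -mul_polyC size_MXaddC polyC_eq0 size_polyC (gt_eqF dc0).
have lL : lead_coef L = d * c.
  by rewrite lead_coefE sL /L coefD coefZ coefX coefC mulr1 addr0.
have sT : (size T <= e)%N by apply: size_complete_power; rewrite sP.
have [|N1 HN1] := @poly_eventually_gt0 L; first by rewrite lL.
have lLe : 0 < lead_coef (L ^+ e) by rewrite lead_coef_exp lL exprn_gt0.
have sLe : (size T < size (L ^+ e)%R)%N.
  have sLe : size (L ^+ e)%R = e.+1.
    by rewrite polySpred -?lead_coef_eq0 ?gt_eqF // size_exp sL mul1n.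
  by rewrite sLe ltnS.
have [N2 HN2] := poly_eventually_dominated (2 * s ^+ e.+1) lLe sLe.
(* At g j the value s ^ (d j) of P is a d-th power. *)
pose g j := f (e.+1 * j)%N; pose y j := L.[(g j)%:Z].
have [J0 HJ0] := unb (N1 + N2)%N; pose J := J0.+1.
have Hg j : (J <= j)%N -> (N1 + N2 <= g j)%N by move=> ?; apply: HJ0; nia.
have y_gt0 j : (J <= j)%N -> 0 < y j by move=> /Hg ?; apply: HN1; lia.
(* The factor s ^ (e+1) anticipates the coefficient of T (g j) in the recurrence
below, the factor 2 the one in close_powers_eq. *)
have HT j : (J <= j)%N -> 2 * s ^+ e.+1 * `|T.[(g j)%:Z]| < y j ^+ e.
  by move=> /Hg ?; rewrite /y -horner_exp; apply: HN2; lia.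
have PgE j : (J <= j)%N -> P.[(g j)%:Z] = (s ^+ j) ^+ e.+1.
  by move=> lej; rewrite Hf ?muln_gt0 -?exprM 1?mulnC //; lia.
have TE j : (J <= j)%N -> T.[(g j)%:Z] = K * (s ^+ j) ^+ e.+1 - y j ^+ e.+1.
  by move=> lej; rewrite /T hornerD hornerN hornerZ horner_exp PgE.
have se1 : 1 <= s ^+ e.+1 by have := ltn_exprz e.+1 s1; lia.
have yS j : (J <= j)%N -> y j.+1 = s * y j.
  move=> lej; have lej1 : (J <= j.+1)%N by lia.
  have y0 := y_gt0 _ lej; have y1 := y_gt0 _ lej1.
  apply: (@close_powers_eq _ _ e); [lia | nia |].
  have t0 := HT _ lej; have t1 := HT _ lej1.
  have le0 : y j ^+ e <= (s * y j) ^+ e.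
    by apply: lerXn2r; rewrite ?nnegrE; nia.
  have -> : y j.+1 ^+ e.+1 - (s * y j) ^+ e.+1
      = s ^+ e.+1 * T.[(g j)%:Z] - T.[(g j.+1)%:Z].
    by rewrite !TE // [s ^+ j.+1]exprS !exprMn; ring.
  have := ler_normB (s ^+ e.+1 * T.[(g j)%:Z]) T.[(g j.+1)%:Z].
  rewrite normrM [`|s ^+ _|]ger0_norm; last by lia.
  nia.
have yE i : y (J + i)%N = s ^+ i * y J.
  elim: i => [|i IHi]; first by rewrite addn0 mul1r.
  by rewrite addnS yS ?leq_addr // IHi exprS mulrA.
pose u := y J; have u0 : 0 < u := y_gt0 J (leqnn J).
pose v := s ^+ J; have v0 : 0 < v by rewrite exprn_gt0 //; lia.
(* Both sides agree at every g (J + i), hence at arbitrarily large points. *)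
have eqP : u ^+ e.+1 *: P = (v *: L) ^+ e.+1.
  apply/eqP; rewrite -subr_eq0; apply/negPn/negP => /poly_eventually_neq0[N HN].
  have [J1 HJ1] := unb N.
  have /HJ1/HN : (J1 <= e.+1 * (J + J1))%N by nia.
  rewrite -/(g (J + J1)%N).
  rewrite hornerD hornerN hornerZ horner_exp hornerZ PgE ?leq_addr //.
  by rewrite -/(y (J + J1)%N) yE -/u /v exprD !exprMn => /eqP[]; ring.
move: eqP; rewrite /L scalerDr scalerA -[v *: _%:P]mul_polyC -polyCM => eqP.
have A0 : 0 < v * (d * c) by rewrite mulr_gt0.
have [a [b [a0 PE]]] := linear_exp_divide (ltn0Sn e) u0 A0 eqP.
by exists a, b, e.+1.
Qed.

(** * The congruence condition *)

(** For even d, a d-th power determines its base only up to sign; taking the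
indices so large that a X + b is positive removes the ambiguity. *)
Lemma linear_power_dvd (a b s : int) (d : nat) (f : nat -> nat) :
    0 < a -> (0 < d)%N -> 1 < s ->
    (forall k, (0 < k)%N -> ((a *: 'X + b%:P) ^+ d).[(f k)%:Z] = s ^+ k) ->
  (a %| b * (b - 1))%Z.
Proof.
move=> a0 d0 s1 Hf.
have [J HJ] := power_indices_unbounded s1 Hf `|b|.+1.
pose l k := a * (f k)%:Z + b.
have l_gt0 k : (J <= k)%N -> 0 < l k.
  move/HJ => ltb; rewrite /l.
  have : (f k)%:Z <= a * (f k)%:Z by rewrite ler_peMl.
  by lia.
have Hl k : (0 < k)%N -> l k ^+ d = s ^+ k.
  by move/Hf; rewrite horner_exp hornerD hornerZ hornerX hornerC.
have leJ : (J <= J.+1)%N by []; have leJ2 : (J <= J.+1 * 2)%N by lia.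
have eql : l (J.+1 * 2)%N = l J.+1 ^+ 2.
  apply/eqP; rewrite -(eqrXn2 d0) ?exprn_ge0 ?ltW ?l_gt0 //.
  by rewrite exprAC !Hl // exprM.
move: eql; rewrite /l expr2.
move: (f (J.+1 * 2)%N)%:Z (f J.+1)%:Z => m n eql.
by apply/dvdzP; exists (m - a * n * n - 2 * n * b); lia.
Qed.

(** * From the subsemigroup to powers of one value *)

Lemma subsemigroup_expr (S : set rat) x k :
  posrat_subsemigroup S -> S x -> (0 < k)%N -> S (x ^+ k).
Proof.
move=> [_ SM] Sx; case: k => // k _.
by elim: k => // k IHk; rewrite exprS; apply: SM.
Qed.

(** An infinite subsemigroup has an element other than 1; as a positive integer
it is some s > 1, and all powers of s lie in the subsemigroup. *)
Lemma subsemigroup_power_values (P : {poly int}) (S : set rat) :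
    posrat_subsemigroup S -> infinite_set S -> S `<=` poly_values P ->
  exists (s : int) (f : nat -> nat),
    1 < s /\ forall k, (0 < k)%N -> P.[(f k)%:Z] = s ^+ k.
Proof.
move=> Ssg Sinf Sval.
have [x [Sx x1]] : exists x, S x /\ x != 1.
  apply: contrapT => noS; apply: Sinf.
  apply: (sub_finite_set _ (finite_set1 (1 : rat))) => x Sx /=.
  by apply: contrapT => /eqP x1; apply: noS; exists x.
have [m _ Pm] := Sval _ Sx.
pose s := P.[m%:Z]; exists s.
have xs : x = s%:~R by rewrite -Pm.
have s1 : 1 < s.
  have := Ssg.1 _ Sx; move: x1; rewrite xs ltr0z -[1]/(1%:~R) eqr_int; lia.
have ex k : exists n : nat, (0 < k)%N ==> (P.[n%:Z] == s ^+ k).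
  case: (posnP k) => [->|k0]; first by exists 0%N.
  have [n _ Pn] := Sval _ (subsemigroup_expr Ssg Sx k0).
  by exists n; apply/implyP => _; rewrite -(eqr_int rat) Pn xs rmorphXn.
exists (fun k => sval (sigW (ex k))); split=> // k k0.
by case: sigW => n /= /implyP/(_ k0)/eqP.
Qed.

(** * The converse *)

(** The product is congruent to b ^ 2, hence to b, modulo a; the positivity of both
factors ensures that the new argument k is positive as well. *)
Lemma linear_values_mulr_closed (a b : int) (n m : nat) :
    0 < a -> (a %| b * (b - 1))%Z -> 0 < a * n%:Z + b -> 0 < a * m%:Z + b ->
    (0 < n)%N -> (0 < m)%N ->
  exists2 k : nat, (0 < k)%N &
    a * k%:Z + b = (a * n%:Z + b) * (a * m%:Z + b).
Proof.
move=> a0 /dvdzP[q bq] ln lm n0 m0.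
pose k : int := a * n%:Z * m%:Z + b * (n%:Z + m%:Z) + q.
have kE : a * k + b = (a * n%:Z + b) * (a * m%:Z + b).
  have bb : b * b = b + q * a by lia.
  have -> : (a * n%:Z + b) * (a * m%:Z + b)
      = a * (a * n%:Z * m%:Z + b * (n%:Z + m%:Z)) + b * b by ring.
  by rewrite bb /k; ring.
have k0 : 0 < k.
  (* If b <= 0, then a k is at least the positive product; otherwise k is a sum
     of nonnegative terms of which the first is positive. *)
  case: (lerP b 0) => b0.
    have : 0 < a * k by have := mulr_gt0 ln lm; lia.
    by rewrite pmulr_rgt0.
  have q0 : 0 <= q by have : 0 <= q * a by [rewrite -bq; nia]; rewrite pmulr_lge0.
  have : 0 < a * n%:Z * m%:Z by rewrite !mulr_gt0.
  have : 0 < b * (n%:Z + m%:Z) by rewrite mulr_gt0 //; lia.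
  by rewrite /k; lia.
by exists `|k|%N; [lia | rewrite gez0_abs ?kE // ltW].
Qed.

Lemma linear_power_subsemigroup (a b : int) (d : nat) :
    0 < a -> (0 < d)%N -> (a %| b * (b - 1))%Z ->
  exists S : set rat,
    [/\ posrat_subsemigroup S, infinite_set S
      & S `<=` poly_values ((a *: 'X + b%:P) ^+ d)].
Proof.
move=> a0 d0 adv; set P := _ ^+ d.
have PE n : P.[n%:Z] = (a * n%:Z + b) ^+ d.
  by rewrite /P horner_exp hornerD hornerZ hornerX hornerC.
(* Bases a n + b < 0 must be left out even when d is even: with a = 6, b = -8
and d = 2, the product of (-2) ^ 2 and 10 ^ 2 is not a value of P at a positive
integer. *)
pose D := [set n : nat | (0 < n)%N /\ 0 < a * n%:Z + b].
exists [set P.[n%:Z]%:~R | n in D]; split; last first.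
- by move=> _ [n [n0 _] <-]; exists n.
- (* Beyond |b| the bases a n + b are positive, so n |-> P n is injective. *)
  pose g i : rat := P.[(`|b|.+1 + i)%N%:Z]%:~R.
  have ginj : injective g.
    move=> i j /eqP; rewrite eqr_int !PE eqrXn2 //; [|nia..].
    by move=> /eqP; nia.
  move=> /(finite_preimage (in2W ginj)); apply: contra_not infinite_nat => finS.
  apply: sub_finite_set finS => i _ /=.
  by exists (`|b|.+1 + i)%N => //; split; nia.
- split=> [_ [n [_ ln] <-]|_ _ [n [n0 ln] <-] [m [m0 lm] <-]].
    by rewrite ltr0z PE exprn_gt0.
  have [k k0 kE] := linear_values_mulr_closed a0 adv ln lm n0 m0.
  exists k; first by split=> //; rewrite kE mulr_gt0.
  by rewrite !PE kE exprMn rmorphM.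
Qed.

Theorem theorem1p9 (P : {poly int}) :
  (exists S : set rat,
     [/\ posrat_subsemigroup S, infinite_set S & S `<=` poly_values P])
  <->
  (exists (a d : nat) (b : int),
     [/\ (0 < a)%N, (0 < d)%N, (a%:Z %| b * (b - 1))%Z
       & P = (a%:Z *: 'X + b%:P) ^+ d]).
Proof.
split=> [[S [Ssg Sinf Sval]]|[a [d [b [a0 d0 adv ->]]]]]; last first.
  exact: linear_power_subsemigroup.
have [s [f [s1 Hf]]] := subsemigroup_power_values Ssg Sinf Sval.
have [a [b [d [a0 d0 PE]]]] := linear_power_of_values s1 Hf.
rewrite PE in Hf; have adv := linear_power_dvd a0 d0 s1 Hf.
by exists `|a|%N, d, b; rewrite gtz0_abs ?absz_gt0 ?gt_eqF.
Qed.
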